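(* Let $K$ be a field, $n\ge 1$ and $q\ge 2$ integers, and let $\mathcal{A}$ be a subalgebra of the algebra $\mathrm{U}_n(K)$ of upper triangular $n\times n$ matrices over $K$. (1) If $\mathcal{A}$ is a maximal D$_q$ subalgebra of $\mathrm{M}_n(K)$, then $\mathcal{A}$ is a D$_q$ subalgebra of $\mathrm{M}_n(K)$ of some type $(n_1,n_2,\ldots,n_q)$ with max-comm db's. (2) If $\mathcal{A}$ is a D$_q$ subalgebra of $\mathrm{M}_n(K)$ with maximum dimension, then $\mathcal{A}$ is a max-dim D$_q$ subalgebra of $\mathrm{M}_n(K)$ of some type $(n_1,n_2,\ldots,n_q)$ with max-dim db's.
   Context: All algebras are associative and unital over the field $K$; a subalgebra of $\mathrm{M}_n(K)$ is a (unital) $K$-subalgebra. $[x,y]=xy-yx$. An algebra is D$_q$ if it satisfies the identity $[x_1,y_1][x_2,y_2]\cdots[x_q,y_q]=0$. Convention: whenever a D$_q$ subalgebra of $\mathrm{M}_n(K)$ is considered, it is assumed that $q\ge 2$ and that it is not D$_{q-1}$. A maximal D$_q$ subalgebra is one maximal with respect to inclusion among D$_q$ subalgebras of $\mathrm{M}_n(K)$; a D$_q$ subalgebra of $\mathrm{M}_n(K)$ with maximum dimension is one whose $K$-dimension is the largest possible among D$_q$ subalgebras of $\mathrm{M}_n(K)$. For positive integers $n_1,\ldots,n_q$ ($q\ge 2$) with $n_1+\cdots+n_q=n$, view matrices in $\mathrm{M}_n(K)$ as $q\times q$ block matrices whose $(i,j)$ block has size $n_i\times n_j$. A subalgebra $\mathcal{A}$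 of $\mathrm{M}_n(K)$ is of type $(n_1,\ldots,n_q)$ if there are subalgebras $\mathcal{A}_{ii}$ of $\mathrm{M}_{n_i}(K)$, $i=1,\ldots,q$ (its diagonal blocks), such that $\mathcal{A}$ consists of exactly all block matrices whose $(i,i)$ block lies in $\mathcal{A}_{ii}$ (independently for each $i$), whose $(i,j)$ block is an arbitrary element of $\mathrm{M}_{n_i\times n_j}(K)$ for $i<j$, and whose $(i,j)$ block is zero for $i>j$. It is - a D$_q$ subalgebra of $\mathrm{M}_n(K)$ of type $(n_1,\ldots,n_q)$ with max-comm db's if every $\mathcal{A}_{ii}$ is a maximal commutative subalgebra of $\mathrm{M}_{n_i}(K)$; - a max-dim D$_q$ subalgebra of $\mathrm{M}_n(K)$ of type $(n_1,\ldots,n_q)$ with max-dim db's if every $\mathcal{A}_{ii}$ is a commutative subalgebra of $\mathrm{M}_{n_i}(K)$ of maximum dimension (equal to $\lfloor n_i^2/4\rfloor+1$) and $\mathcal{A}$ is a D$_q$ subalgebra of $\mathrm{M}_n(K)$ with maximum dimension. *)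

(* Defs.v *)
From HB Require Import structures.
From mathcomp Require Import all_boot all_order all_algebra.

Set Implicit Arguments.
Unset Strict Implicit.
Unset Printing Implicit Defensive.

Import GRing.Theory.
Local Open Scope ring_scope.

(* Subspaces are used instead of {aspace _} because 'M[K]_n is a library
   (unital, nontrivial) algebra only when n is syntactically a successor. *)
Definition is_subalgebra (K : fieldType) (n : nat) (A : {vspace 'M[K]_n}) : Prop :=
  1%:M \in A /\ {in A &, forall x y, x *m y \in A}.

Definition is_upper_triangular (K : fieldType) (n : nat) (M : 'M[K]_n) : Prop :=
  forall i j : 'I_n, (j < i)%N -> M i j = 0.

Definition commutator (K : fieldType) (n : nat) (x y : 'M[K]_n) : 'M[K]_n :=
  x *m y - y *m x.

Definition satisfies_D (K : fieldType) (n q : nat) (A : {vspace 'M[K]_n}) : Prop :=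
  forall x y : 'I_q -> 'M[K]_n,
    (forall i, x i \in A) -> (forall i, y i \in A) ->
    \big[mulmx/1%:M]_(i < q) commutator (x i) (y i) = 0.

(* By convention a D_q subalgebra (q >= 2) is required not to be D_{q-1}. *)
Definition is_D_subalgebra (K : fieldType) (n q : nat) (A : {vspace 'M[K]_n}) : Prop :=
  [/\ is_subalgebra A, satisfies_D q A & ~ satisfies_D q.-1 A].

Definition is_comm_subalgebra (K : fieldType) (n : nat) (A : {vspace 'M[K]_n}) : Prop :=
  is_subalgebra A /\ {in A &, forall x y, x *m y = y *m x}.

Definition maximal_for (K : fieldType) (n : nat)
    (P : {vspace 'M[K]_n} -> Prop) (A : {vspace 'M[K]_n}) : Prop :=
  P A /\ forall B, P B -> (A <= B)%VS -> B = A.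

Definition maxdim_for (K : fieldType) (n : nat)
    (P : {vspace 'M[K]_n} -> Prop) (A : {vspace 'M[K]_n}) : Prop :=
  P A /\ forall B, P B -> (\dim B <= \dim A)%N.

Definition blk (K : fieldType) (n q : nat) (ns : 'I_q -> nat)
    (sum_ns : (\sum_(i < q) ns i)%N = n) (M : 'M[K]_n) (i j : 'I_q) :
    'M[K]_(ns i, ns j) :=
  submxblock (castmx (esym sum_ns, esym sum_ns) M) i j.

Definition has_type (K : fieldType) (n q : nat) (A : {vspace 'M[K]_n})
    (ns : 'I_q -> nat) (D : forall i : 'I_q, {vspace 'M[K]_(ns i)}) : Prop :=
  [/\ forall i, (0 < ns i)%N,
      forall i, is_subalgebra (D i) &
      exists sum_ns : (\sum_(i < q) ns i)%N = n,
        forall M : 'M[K]_n,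
          M \in A <->
          (forall i, blk sum_ns M i i \in D i) /\
          (forall i j : 'I_q, (j < i)%N -> blk sum_ns M i j = 0)].

Definition D_of_type_max_comm (K : fieldType) (n q : nat)
    (A : {vspace 'M[K]_n}) (ns : 'I_q -> nat) : Prop :=
  exists D : forall i : 'I_q, {vspace 'M[K]_(ns i)},
    [/\ is_D_subalgebra q A,
        has_type A D &
        forall i, maximal_for (@is_comm_subalgebra K (ns i)) (D i)].

Definition maxdim_D_of_type_max_dim (K : fieldType) (n q : nat)
    (A : {vspace 'M[K]_n}) (ns : 'I_q -> nat) : Prop :=
  exists D : forall i : 'I_q, {vspace 'M[K]_(ns i)},
    [/\ has_type A D,
        forall i, maxdim_for (@is_comm_subalgebra K (ns i)) (D i) &
        maxdim_for (@is_D_subalgebra K n q) A].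

(* Main.v *)
(* Let W_0 = K^n and let W_(i+1) be the span of all W_i [x, y] with x, y in A
   (row vectors, matrices acting on the right). Since A[x, y] is contained in
   [A, A]A, this is a flag of A-submodules; it is strictly decreasing and
   reaches 0 exactly at step q, because A is D_q but not D_(q-1). Adding to A
   all M with W_i M <= W_(i+1) keeps it a D_q algebra, so a maximal A already
   contains them. They act so transitively that any subspace stable under A is
   comparable with each W_i; applied to the coordinate subspaces preserved by
   the triangular algebra A, this makes every W_i a coordinate subspace. The
   jumps of the flag are the block sizes, the diagonal blocks of A commute, and
   the full block algebra on these diagonal blocks is D_q and contains A, hence
   equals A. Enlarging or replacing one diagonal block by another commutative
   algebra again gives a D_q algebra, whence the maximality of the blocks. *)
Require Import Defs.
From HB Require Import structures.
From mathcomp Require Import all_boot all_order all_algebra.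

Set Implicit Arguments.
Unset Strict Implicit.
Unset Printing Implicit Defensive.

Import GRing.Theory.
Local Open Scope ring_scope.

(** * Commutator identity and maximality *)

Section Commutators.
Variables (K : fieldType) (n : nat).
Implicit Types (A B : {vspace 'M[K]_n}) (x y z : 'M[K]_n).

(** The derivation rule for [[x, -]], solved for [[x, y] z]; it turns right multiplication of a
    commutator into left multiplication. *)
Lemma commutator_mulr x y z :
  commutator x y *m z = commutator x (y *m z) - y *m commutator x z.
Proof.
by rewrite /commutator mulmxBl mulmxBr !mulmxA opprB subrKA.
Qed.

Lemma satisfies_D_sub q A B :
  (A <= B)%VS -> satisfies_D q B -> satisfies_D q A.
Proof. by move=> /subvP sAB DB x y Ax Ay; apply: DB => i; apply: sAB. Qed.

(** Failing D_(q-1) is inherited by larger algebras, so an enlargement of [A] need only be shown to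
    be D_q. *)
Lemma maximal_D_unique q A B :
  maximal_for (@is_D_subalgebra K n q) A -> (A <= B)%VS ->
  is_subalgebra B -> satisfies_D q B -> B = A.
Proof.
move=> [[_ _ nDA] maxA] sAB algB DB; apply: maxA => //.
by split=> // DB'; apply/nDA/(satisfies_D_sub sAB).
Qed.

Lemma maxdim_maximal (P : {vspace 'M[K]_n} -> Prop) A :
  maxdim_for P A -> maximal_for P A.
Proof.
move=> [PA maxA]; split=> // B PB sAB; apply/esym/eqP.
by rewrite eqEdim sAB maxA.
Qed.

End Commutators.

(** * Block decomposition and block triangular algebras *)

Section Blocks.
Variables (K : fieldType) (n q : nat) (ns : 'I_q -> nat).
Variable sum_ns : (\sum_(i < q) ns i)%N = n.
Implicit Types (M : 'M[K]_n) (i j k : 'I_q).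

Definition rank_ord i (a : 'I_(ns i)) : 'I_n := cast_ord sum_ns (tagnat.Rank i a).

Lemma val_rank_ord i (a : 'I_(ns i)) :
  rank_ord a = (\sum_(k < q | (k < i)%N) ns k + a)%N :> nat.
Proof. exact: tagnat.RankEsum. Qed.

Lemma blkE M i j a b : blk sum_ns M i j a b = M (rank_ord a) (rank_ord b).
Proof. by rewrite mxE castmxE !esymK. Qed.

Lemma blkP M N : (forall i j, blk sum_ns M i j = blk sum_ns N i j) -> M = N.
Proof.
rewrite /blk; case: n / sum_ns M N => M N /= eqMN.
by apply/mxblockP => i j; have := eqMN i j; rewrite !castmx_id.
Qed.

Definition block_entry i j M := blk sum_ns M i j.

Fact block_entry_is_linear i j : linear (block_entry i j).
Proof. by move=> a M N; apply/matrixP => s t; rewrite [RHS]mxE [X in _ = X + _]mxE !blkE !mxE. Qed.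

HB.instance Definition _ i j := GRing.isLinear.Build K 'M[K]_n 'M[K]_(ns i, ns j)
  _ (block_entry i j) (block_entry_is_linear i j).

Lemma blkB M N i j :
  blk sum_ns (M - N) i j = blk sum_ns M i j - blk sum_ns N i j.
Proof. exact: (linearB (block_entry i j)). Qed.

Lemma blk_mul M N i j :
  blk sum_ns (M *m N) i j = \sum_k blk sum_ns M i k *m blk sum_ns N k j.
Proof.
rewrite /blk; case: n / sum_ns M N => M N; rewrite !castmx_id.
by rewrite -{1}[M]submxblockK -{1}[N]submxblockK mul_mxblock mxblockK.
Qed.

Lemma blk1 i : blk sum_ns 1%:M i i = 1%:M :> 'M[K]_(ns i).
Proof.
apply/matrixP => a b; rewrite blkE !mxE -val_eqE /=.
by rewrite tagnat.eq_Rank eqxx.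
Qed.

Lemma blk1_neq i j : i != j -> blk sum_ns 1%:M i j = 0 :> 'M[K]_(ns i, ns j).
Proof.
move=> neq_ij; apply/matrixP => a b; rewrite blkE !mxE -val_eqE /=.
by rewrite tagnat.eq_Rank (negPf neq_ij).
Qed.

Definition block_upper M := forall i j, (j < i)%N -> blk sum_ns M i j = 0.

Lemma blk_mul_diag M N i : block_upper M -> block_upper N ->
  blk sum_ns (M *m N) i i = blk sum_ns M i i *m blk sum_ns N i i.
Proof.
move=> upM upN; rewrite blk_mul (bigD1 i) //= big1 ?addr0 // => k.
rewrite neq_ltn => /orP[ltki|ltik]; first by rewrite upM ?mul0mx.
by rewrite upN ?mulmx0.
Qed.

Lemma block_upper_mul M N : block_upper M -> block_upper N -> block_upper (M *m N).
Proof.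
move=> upM upN i j ltji; rewrite blk_mul big1 // => k _.
case: (ltnP k i) => [ltki|leik]; first by rewrite upM ?mul0mx.
by rewrite upN ?mulmx0 // (leq_trans ltji).
Qed.

(** For [j < i], block [j] ends before block [i] starts, so every entry of block [(i, j)] lies
    strictly below the diagonal. *)
Lemma upper_triangular_block_upper M : is_upper_triangular M -> block_upper M.
Proof.
move=> upM i j ltji; apply/matrixP => a b; rewrite blkE mxE upM //.
rewrite !val_rank_ord; apply: leq_trans (leq_addr _ _).
rewrite [X in (_ < X)%N](bigD1 j) //= addnC.
apply: leq_trans (leq_add (ltn_ord b) (leqnn _)) _; rewrite leq_add2l.
rewrite [leqRHS](eq_bigl (fun k : 'I_q => (k < i)%N && (k != j))) //.
rewrite [leqLHS]big_mkcond [leqRHS]big_mkcond; apply: leq_sum => k _.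
by case: ltnP => // ltkj; rewrite (ltn_trans ltkj ltji) neq_ltn ltkj.
Qed.

(* Each strictly block upper triangular factor moves the support one more
   block away from the diagonal. *)
Lemma blk_prod_strict (m : nat) (c : 'I_m -> 'M[K]_n) :
  (forall l i j, (j <= i)%N -> blk sum_ns (c l) i j = 0) ->
  forall i j, (j < i + m)%N -> blk sum_ns (\big[mulmx/1%:M]_(l < m) c l) i j = 0.
Proof.
elim: m c => [|m IHm] c strict_c i j.
  by rewrite addn0 big_ord0 => ltji; rewrite blk1_neq // neq_ltn ltji orbT.
move=> ltj; rewrite big_ord_recl blk_mul big1 // => l _.
case: (leqP l i) => [leli|ltil]; first by rewrite strict_c ?mul0mx.
rewrite IHm ?mulmx0 // => [l' i' j' leji|]; first exact: strict_c.
by apply: leq_trans ltj _; rewrite addnS -addSn leq_add2r.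
Qed.

Section BlockAlgebra.
Variable D : forall i, {vspace 'M[K]_(ns i)}.

(** Preimages and kernels of linear maps are intersected so that the result is a subspace by
    construction. *)
Definition block_alg : {vspace 'M[K]_n} :=
  (\bigcap_i (linfun (block_entry i i) @^-1: D i)
   :&: \bigcap_(p : 'I_q * 'I_q | (p.2 < p.1)%N)
         lker (linfun (block_entry p.1 p.2)))%VS.

Lemma mem_block_alg M : M \in block_alg <->
  (forall i, blk sum_ns M i i \in D i) /\ block_upper M.
Proof.
split=> [/memv_capP[]|[DM upM]].
  rewrite !memvE => /subv_bigcapP DM /subv_bigcapP upM; split=> [i|i j ltji].
    by have := DM i isT; rewrite -memvE -memv_preim lfunE.
  by have := upM (i, j) ltji; rewrite -memvE memv_ker lfunE => /eqP.
apply/memv_capP; rewrite !memvE; split; apply/subv_bigcapP => i.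
  by move=> _; rewrite -memvE -memv_preim lfunE; exact: DM.
by move=> lti; rewrite -memvE memv_ker lfunE; apply/eqP/upM.
Qed.

Lemma block_alg_subalgebra :
  (forall i, is_subalgebra (D i)) -> is_subalgebra block_alg.
Proof.
move=> algD; split=> [|M N /mem_block_alg[DM upM] /mem_block_alg[DN upN]].
  apply/mem_block_alg; split=> [i|i j ltji]; first by rewrite blk1; case: (algD i).
  by rewrite blk1_neq // neq_ltn ltji orbT.
apply/mem_block_alg; split=> [i|]; last exact: block_upper_mul.
by rewrite blk_mul_diag //; apply: (algD i).2 _ _ (DM i) (DN i).
Qed.

(** Diagonal blocks multiply separately and commute, so commutators are strictly block upper
    triangular, and a product of [q] of them vanishes. *)
Lemma block_alg_D :
  (forall i, is_comm_subalgebra (D i)) -> satisfies_D q block_alg.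
Proof.
move=> commD x y Ax Ay; apply: blkP => i j.
rewrite [RHS](linear0 (block_entry i j)).
apply: blk_prod_strict => [l {}i {}j|]; last by rewrite (leq_trans (ltn_ord j)) ?leq_addl.
have [/mem_block_alg[Dx upx] /mem_block_alg[Dy upy]] := (Ax l, Ay l).
rewrite blkB leq_eqVlt => /orP[/eqP/val_inj eqji|ltji]; last first.
  by rewrite !block_upper_mul // subr0.
by rewrite -{i}eqji !blk_mul_diag // ((commD j).2 _ _ (Dx j) (Dy j)) subrr.
Qed.

(** The witness is block diagonal, with [X] at place [i] and zeros elsewhere. *)
Lemma block_diag_lift i (X : 'M[K]_(ns i)) : X \in D i ->
  exists2 M, M \in block_alg & blk sum_ns M i i = X.
Proof.
move=> DX; pose F := dfwith (fun j => 0 : 'M[K]_(ns j)) X.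
exists (castmx (sum_ns, sum_ns) (\mxdiag_j F j)); last first.
  by rewrite /blk castmxK submxblock_diag /F dfwith_in.
apply/mem_block_alg; split=> [j|j k ltkj]; rewrite /blk castmxK.
  rewrite submxblock_diag /F.
  by case: dfwithP => // k _; apply: mem0v.
by rewrite mxblockK; case: eqP => // eqjk; rewrite eqjk ltnn in ltkj.
Qed.

Lemma block_alg_img i :
  (linfun (block_entry i i) @: block_alg)%VS = D i.
Proof.
apply/vspaceP => X; apply/memv_imgP/idP => [[M /mem_block_alg[DM _] ->]|].
  by rewrite lfunE; apply: DM.
by case/block_diag_lift => M AM <-; exists M => //; rewrite lfunE.
Qed.

End BlockAlgebra.
End Blocks.

(** With [e k] the projection onto block [k] and [d k] the matrix unit from the first index of block
    [k] to that of block [k.+1], one has [[e k, d k] = d k]; the product of the [q.-1] units [d k]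
    is nonzero. *)
Lemma block_alg_notD (K : fieldType) (n q : nat) (ns : 'I_q -> nat)
    (sum_ns : (\sum_(i < q) ns i)%N = n) (D : forall i, {vspace 'M[K]_(ns i)}) :
  (0 < q)%N -> (forall i, (0 < ns i)%N) -> (forall i, is_subalgebra (D i)) ->
  ~ satisfies_D q.-1 (block_alg sum_ns D).
Proof.
case: q ns sum_ns D => // m ns sum_ns D _ ns_gt0 algD.
(* Indexing by naturals through [inord] allows index shifts in the induction on products; only
   [k <= m] matters. *)
pose a k : 'I_n := rank_ord sum_ns (Ordinal (ns_gt0 (inord k))).
pose blk_of (r : 'I_n) : 'I_m.+1 := tagnat.sig1 (cast_ord (esym sum_ns) r).
have blk_rank i (b : 'I_(ns i)) : blk_of (rank_ord sum_ns b) = i.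
  by rewrite /blk_of cast_ordK tagnat.Rank1K.
pose e k : 'M[K]_n := diag_mx (\row_r (blk_of r == inord k)%:R).
pose d k : 'M[K]_n := delta_mx (a k) (a k.+1).
have inord_lt k : (k < m)%N -> ((inord k : 'I_m.+1) < (inord k.+1 : 'I_m.+1))%N.
  by move=> ltkm; rewrite !inordK // ltnS ltnW.
have Ae k : e k \in block_alg sum_ns D.
  apply/mem_block_alg; split=> [i|i j ltji].
    have -> : blk sum_ns (e k) i i = (i == inord k)%:R *: 1%:M.
      apply/matrixP => s t; rewrite blkE !mxE blk_rank mulr_natr; congr (_ *+ _).
      by rewrite -val_eqE /= tagnat.eq_Rank eqxx.
    by apply: memvZ; case: (algD i).
  apply/matrixP => s t; rewrite blkE !mxE; case: (rank_ord _ s =P _) => // eq_st.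
  by rewrite -(blk_rank i s) eq_st blk_rank ltnn in ltji.
have Ad k : (k < m)%N -> d k \in block_alg sum_ns D.
  move=> ltkm; have blk_d (i j : 'I_m.+1) : (j <= i)%N -> blk sum_ns (d k) i j = 0.
    move=> leji; apply/matrixP => s t; rewrite blkE !mxE.
    case: eqP => //= eq_s; case: eqP => //= eq_t.
    move: leji; rewrite -(blk_rank i s) -(blk_rank j t) eq_s eq_t !blk_rank.
    by rewrite leqNgt inord_lt.
  apply/mem_block_alg; split=> [i|i j ltji]; last by rewrite blk_d // ltnW.
  by rewrite blk_d // mem0v.
move/(_ (fun l : 'I_m => e l) (fun l : 'I_m => d l)) => /(_ (fun l => Ae l)).
move/(_ (fun l => Ad l (ltn_ord l))).
have comm_ed (l : 'I_m) : true -> commutator (e l) (d l) = d l.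
  move=> _; have neq : (inord l == inord l.+1 :> 'I_m.+1) = false.
    by apply/negbTE; rewrite -val_eqE neq_ltn inord_lt.
  rewrite /commutator mul_diag_mx mul_mx_diag.
  apply/matrixP => r s; rewrite !mxE.
  case: (r =P a l) => [->|_] /=; last by rewrite mulr0 mul0r subr0.
  case: (s =P a l.+1) => [->|_] /=; last by rewrite mulr0 mul0r subr0.
  by rewrite !blk_rank eqxx [_ == inord l]eq_sym neq mulr1 mulr0 subr0.
rewrite (eq_bigr _ comm_ed) => prod0.
(* The start [i] is general for the induction on the length [p]; the left factor makes the empty
   product a matrix unit too. *)
have path_prod p i :
    delta_mx (a i) (a i) *m (\big[mulmx/1%:M]_(l < p) (d (i + l)%N : 'M[K]_n))
    = delta_mx (a i) (a (i + p)%N).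
  elim: p i => [|p IHp] i; first by rewrite big_ord0 mulmx1 addn0.
  rewrite big_ord_recl mulmxA addn0 mul_delta_mx -(mul_delta_mx (a i.+1)) -mulmxA.
  under eq_bigr do rewrite /= /bump add1n addnS -addSn.
  by rewrite IHp mul_delta_mx addSnnS.
have := path_prod m 0%N; rewrite (prod0 : \big[mulmx/1%:M]_(l < m) d (0 + l)%N = 0).
move=> /matrixP/(_ (a 0%N) (a m)); rewrite mulmx0 !mxE !eqxx => /esym/eqP.
by rewrite oner_eq0.
Qed.

(** * Flags and the matrices that shift them *)

Section Filtration.
Variables (K : fieldType) (n q : nat) (W : nat -> 'M[K]_n).
Hypothesis W0 : W 0 = 1%:M.
Hypothesis Wq : W q = 0.
Hypothesis W_dec : forall i, (W i.+1 <= W i)%MS.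

Lemma filtration_le i j : (i <= j)%N -> (W j <= W i)%MS.
Proof.
move/subnKC<-; elim: (j - i)%N => [|k IHk]; first by rewrite addn0.
by rewrite addnS; apply: submx_trans IHk.
Qed.

Definition shifts (M : 'M[K]_n) := forall i, (W i *m M <= W i.+1)%MS.

(** Inclusion in [W i.+1] is vanishing modulo its cokernel, a linear condition on [M]. Indices below
    [q] suffice, since the flag is zero from [q] on. *)
Definition shift_space : {vspace 'M[K]_n} :=
  (\bigcap_(i < q) lker (linfun (mulmxr (cokermx (W i.+1)) \o mulmx (W i))))%VS.

Lemma mem_shift_space M : M \in shift_space <-> shifts M.
Proof.
split=> [|shM].
  rewrite memvE => /subv_bigcapP shM i; case: (ltnP i q) => [ltiq|leqi].
    have := shM (Ordinal ltiq) isT.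
    by rewrite -memvE memv_ker lfunE submxE.
  have /submxP[C ->] := filtration_le leqi.
  by rewrite Wq mulmx0 mul0mx sub0mx.
rewrite memvE; apply/subv_bigcapP => i _.
by rewrite -memvE memv_ker lfunE /= -submxE.
Qed.

Lemma shifts_prod m (c : 'I_m -> 'M[K]_n) i : (forall l, shifts (c l)) ->
  (W i *m \big[mulmx/1%:M]_(l < m) c l <= W (i + m)%N)%MS.
Proof.
elim: m c i => [|m IHm] c i sh_c; first by rewrite big_ord0 mulmx1 addn0.
rewrite big_ord_recl mulmxA addnS -addSn.
by apply: submx_trans (submxMr _ (sh_c _ _)) _; apply: IHm.
Qed.

(** A product of [m] shifts maps the whole space [W 0] into [W m], which is zero. *)
Lemma shifts_satisfies_D m (B : {vspace 'M[K]_n}) : (W m <= (0 : 'M[K]_n))%MS ->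
  {in B &, forall x y, shifts (commutator x y)} -> satisfies_D m B.
Proof.
move=> Wm0 shB x y Bx By; apply/eqP; rewrite -submx0.
have := @shifts_prod m (fun l => commutator (x l) (y l)) 0.
rewrite W0 mul1mx => shp.
by apply: submx_trans (shp _) Wm0 => l; apply: shB.
Qed.

Section ShiftSum.
Variable A : {vspace 'M[K]_n}.
Hypothesis algA : is_subalgebra A.
Hypothesis W_stable : forall i, {in A, forall a, (W i *m a <= W i)%MS}.
Hypothesis comm_shifts : {in A &, forall x y, shifts (commutator x y)}.

Let shift_mull a M : a \in A -> shifts M -> a *m M \in shift_space.
Proof.
move=> Aa shM; apply/mem_shift_space => i; rewrite mulmxA.
by apply: submx_trans (submxMr _ (W_stable i Aa)) (shM i).
Qed.

Let shift_mulr a M : a \in A -> shifts M -> M *m a \in shift_space.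
Proof.
move=> Aa shM; apply/mem_shift_space => i; rewrite mulmxA.
by apply: submx_trans (submxMr _ (shM i)) (W_stable _ Aa).
Qed.

Let shift_mul M N : shifts M -> shifts N -> M *m N \in shift_space.
Proof.
move=> shM shN; apply/mem_shift_space => i; rewrite mulmxA.
by apply: submx_trans (submxMr _ (shM i)) (submx_trans (shN _) (W_dec _)).
Qed.

(** Shifts are closed under products, and under multiplication by [A] on either side because [A]
    stabilises each [W i]. *)
Lemma shift_sum_subalgebra : is_subalgebra (A + shift_space)%VS.
Proof.
split=> [|x y /memv_addP[a Aa [M shM ->]] /memv_addP[b Ab [N shN ->]]].
  by apply: subvP (addvSl _ _) _ _; case: algA.
rewrite mulmxDl !mulmxDr -addrA; move/mem_shift_space in shM; move/mem_shift_space in shN.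
apply: memv_add; first exact: algA.2.
apply: memvD; [exact: shift_mull|apply: memvD; [exact: shift_mulr|exact: shift_mul]].
Qed.

(** The commutator of [a + M] and [b + N] differs from [[a, b]] by terms containing [M] or [N], so
    it is again a shift. *)
Lemma shift_sum_D : satisfies_D q (A + shift_space)%VS.
Proof.
apply: shifts_satisfies_D => [|x y]; first by rewrite Wq submx0.
move=> /memv_addP[a Aa [M shM ->]] /memv_addP[b Ab [N shN ->]].
move/mem_shift_space in shM; move/mem_shift_space in shN.
rewrite /commutator; apply/mem_shift_space.
have -> : (a + M) *m (b + N) - (b + N) *m (a + M) = commutator a b
    + ((a *m N + (M *m b + M *m N)) - (b *m M + (N *m a + N *m M))).
  by rewrite !mulmxDl !mulmxDr /commutator [RHS]addrACA -opprD !addrA.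
apply: memvD; first exact/mem_shift_space/comm_shifts.
by apply: memvB; (apply: memvD; [exact: shift_mull|apply: memvD; [exact: shift_mulr|exact: shift_mul]]).
Qed.

End ShiftSum.

(** Levels beyond [j] are killed by [f]; a level [i <= j] is sent into the line of [w], inside
    [W j.+1 <= W i.+1]. *)
Lemma shifts_rank1 j (f : 'cV[K]_n) (w : 'rV[K]_n) :
  W j.+1 *m f = 0 -> (w <= W j.+1)%MS -> shifts (f *m w).
Proof.
move=> Wf0 Ww i; rewrite mulmxA; case: (leqP i j) => [leij|ltji].
  by apply: submx_trans (submxMl _ _) (submx_trans Ww _); apply: filtration_le.
have /submxP[C ->] := filtration_le ltji.
by rewrite -(mulmxA C) Wf0 mulmx0 mul0mx sub0mx.
Qed.

(* A vector of E outside W i.+1 can be sent anywhere in W i.+1 by a rank-one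
   shift, so an E stable under shifts contains W i.+1 unless E <= W i.+1. *)
Lemma shift_stable_comparable (E : 'M[K]_n) i :
  (forall M, shifts M -> (E *m M <= E)%MS) -> (E <= W i)%MS || (W i <= E)%MS.
Proof.
move=> E_stable; elim: i => [|i /orP[_|WiE]]; first by rewrite W0 submx1.
  rewrite submxE; case: eqP => //= /eqP/matrix0Pn[s [t nz_st]].
  apply/row_subP => r; pose f := col t (cokermx (W i.+1)).
  have shM : shifts (f *m row r (W i.+1)).
    by apply: (@shifts_rank1 i); rewrite ?row_sub // /f colE mulmxA mulmx_coker mul0mx.
  have := submx_trans (row_sub s _) (E_stable _ shM).
  rewrite row_mul mulmxA.
  have -> : row s E *m f = ((E *m cokermx (W i.+1)) s t)%:M.
    by apply/matrixP => x y; rewrite !mxE !ord1 eqxx; apply: eq_bigr => k _; rewrite !mxE.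
  by rewrite mul_scalar_mx eqmx_scale.
by rewrite (submx_trans (W_dec i) WiE) orbT.
Qed.

End Filtration.

(** * The flag generated by commutators *)

Section CommutatorFlag.
Variables (K : fieldType) (n : nat) (A : {vspace 'M[K]_n}).
Hypothesis algA : is_subalgebra A.

(** The row space spanned by all [U [x, y]] with [x], [y] in [A]; by bilinearity, pairs of basis
    vectors are enough. *)
Definition comm_step (U : 'M[K]_n) : 'M[K]_n :=
  (\sum_(p : 'I_(\dim A) * 'I_(\dim A))
     U *m commutator (vbasis A)`_p.1 (vbasis A)`_p.2)%MS.

Lemma comm_step_min U (V : 'M[K]_n) :
  {in A &, forall x y, (U *m commutator x y <= V)%MS} -> (comm_step U <= V)%MS.
Proof.
move=> sUV; apply/sumsmx_subP => p _.
by apply: sUV; apply/vbasis_mem/mem_nth; rewrite size_tuple.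
Qed.

Lemma comm_step_sub U : {in A &, forall x y, (U *m commutator x y <= comm_step U)%MS}.
Proof.
move=> x y /coord_vbasis-> /coord_vbasis->; set b := vbasis A.
have -> (f g : 'I_(\dim A) -> K) :
    commutator (\sum_i f i *: b`_i) (\sum_j g j *: b`_j)
    = \sum_i \sum_j (f i * g j) *: commutator b`_i b`_j.
  rewrite /commutator mulmx_suml [X in _ - X]mulmx_sumr -sumrB.
  apply: eq_bigr => i _; rewrite mulmx_sumr mulmx_suml -sumrB.
  apply: eq_bigr => j _.
  by rewrite -!scalemxAl -!scalemxAr !scalerA [g j * _]mulrC -scalerBr.
rewrite mulmx_sumr summx_sub // => i _; rewrite mulmx_sumr summx_sub // => j _.
by rewrite -scalemxAr scalemx_sub // (sumsmx_sup (i, j)).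
Qed.

Lemma comm_stepS (U V : 'M[K]_n) : (U <= V)%MS -> (comm_step U <= comm_step V)%MS.
Proof.
move=> sUV; apply: comm_step_min => x y Ax Ay.
by apply: submx_trans (submxMr _ sUV) (comm_step_sub V Ax Ay).
Qed.

Lemma comm_step_le U : {in A, forall a, (U *m a <= U)%MS} -> (comm_step U <= U)%MS.
Proof.
move=> stU; apply: comm_step_min => x y Ax Ay; apply: stU.
by apply: memvB; apply: algA.2.
Qed.

(** Since [[x, y] a = [x, y a] - y [x, a]], the first term is a commutator again and in the second
    [y] is absorbed by [U]. *)
Lemma comm_step_stable U : {in A, forall a, (U *m a <= U)%MS} ->
  {in A, forall a, (comm_step U *m a <= comm_step U)%MS}.
Proof.
move=> stU a Aa; rewrite sumsmxMr; apply/sumsmx_subP => p _.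
have Ab (i : 'I_(\dim A)) : (vbasis A)`_i \in A.
  by apply/vbasis_mem/mem_nth; rewrite size_tuple.
rewrite -mulmxA commutator_mulr mulmxBr addmx_sub //.
  by apply: comm_step_sub => //; apply: algA.2.
rewrite eqmx_opp mulmxA (submx_trans (submxMr _ (stU _ (Ab _)))) //.
exact: comm_step_sub.
Qed.

Definition comm_flag i := iter i comm_step 1%:M.

Lemma comm_flag_stable i : {in A, forall a, (comm_flag i *m a <= comm_flag i)%MS}.
Proof.
elim: i => [|i IHi]; first by move=> a _; rewrite submx1.
exact: comm_step_stable.
Qed.

Lemma comm_flag_dec i : (comm_flag i.+1 <= comm_flag i)%MS.
Proof. exact/comm_step_le/comm_flag_stable. Qed.

Lemma comm_flag_shifts : {in A &, forall x y, shifts comm_flag (commutator x y)}.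
Proof. by move=> x y Ax Ay i; apply: comm_step_sub. Qed.

Lemma comm_flag_D q : satisfies_D q A -> comm_flag q = 0.
Proof.
(* Each level [i] is annihilated by every product of [q - i] commutators: the induction trades one
   flag step for one more factor, and [m = 0] is the goal. *)
move=> DA; suff annih m i : (i + m = q)%N -> forall x y : 'I_m -> 'M[K]_n,
    (forall l, x l \in A) -> (forall l, y l \in A) ->
    comm_flag i *m \big[mulmx/1%:M]_(l < m) commutator (x l) (y l) = 0.
  have := @annih 0 q (addn0 q) (fun _ => 0) (fun _ => 0).
  by rewrite big_ord0 mulmx1; apply=> l; apply: mem0v.
elim: i m => [|i IHi] m; first by rewrite add0n => -> x y Ax Ay; rewrite [comm_flag 0]/= mul1mx DA.
rewrite addSnnS => eq_q x y Ax Ay; apply/sub_kermxP.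
apply: comm_step_min => a b Aa Ab; apply/sub_kermxP.
pose cons c (z : 'I_m -> 'M[K]_n) (l : 'I_m.+1) := oapp z c (unlift ord0 l).
have Acons c z : c \in A -> (forall l, z l \in A) -> forall l, cons c z l \in A.
  by move=> Ac Az l; rewrite /cons; case: unliftP => //= j _; apply: Az.
have := IHi m.+1 eq_q _ _ (Acons a x Aa Ax) (Acons b y Ab Ay).
rewrite big_ord_recl mulmxA /cons unlift_none /=.
by under eq_bigr do rewrite liftK /=.
Qed.

(** If two consecutive terms agreed, the flag would be constant from [i] on, hence already zero at
    [i <= q.-1], which would make [A] D_(q-1). *)
Lemma comm_flag_strict q i : satisfies_D q A -> ~ satisfies_D q.-1 A ->
  (i < q)%N -> (\rank (comm_flag i.+1) < \rank (comm_flag i))%N.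
Proof.
move=> DA nDA ltiq; rewrite ltn_neqAle mxrankS ?comm_flag_dec // andbT.
apply/negP => /eqP eq_rank; apply: nDA.
have le_next : (comm_flag i <= comm_flag i.+1)%MS.
  by rewrite -(mxrank_leqif_sup (comm_flag_dec i)) eq_rank.
have le_iter k : (comm_flag i <= comm_flag (i + k))%MS.
  elim: k => [|k IHk]; first by rewrite addn0.
  by rewrite addnS; apply: submx_trans le_next (comm_stepS IHk).
have flag_i0 : (comm_flag i <= (0 : 'M[K]_n))%MS.
  by have := le_iter (q - i)%N; rewrite subnKC ?(ltnW ltiq) // (comm_flag_D DA).
apply: (@shifts_satisfies_D _ _ comm_flag) => //; last exact: comm_flag_shifts.
apply: submx_trans _ flag_i0; apply: filtration_le; first exact: comm_flag_dec.
by case: q ltiq {DA}.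
Qed.

End CommutatorFlag.

(** * Coordinate subspaces stable under triangular matrices *)

Section CoordinateFlag.
Variables (K : fieldType) (n : nat).

Lemma copid_mxE s (i j : 'I_n) :
  (copid_mx s : 'M[K]_n) i j = ((i == j) && (s <= i)%N)%:R.
Proof.
rewrite !mxE -[i == j]val_eqE /=.
by case: (_ == _ :> nat); case: ltnP; rewrite /= ?subrr ?subr0.
Qed.

Lemma sub_copid_mxP m s (X : 'M[K]_(m, n)) :
  (forall i (j : 'I_n), (j < s)%N -> X i j = 0) <-> (X <= copid_mx s)%MS.
Proof.
split=> [X0|/submxP[C ->] i j ltjs]; last first.
  rewrite mxE big1 // => k _; rewrite copid_mxE; case: eqP => [->|_]; last by rewrite mulr0.
  by rewrite leqNgt ltjs mulr0.
apply/submxP; exists X; apply/matrixP => i j; rewrite mxE (bigD1 j) //= big1 => [|k nkj].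
  rewrite copid_mxE eqxx addr0 /=; case: leqP => [_|ltjs]; first by rewrite mulr1.
  by rewrite X0 // mul0r.
by rewrite copid_mxE (negPf nkj) mulr0.
Qed.

(** The rows of [copid_mx s] span the basis vectors of index at least [s], and an upper triangular
    matrix acting on the right never lowers indices. *)
Lemma copid_mx_upper s (M : 'M[K]_n) :
  is_upper_triangular M -> (copid_mx s *m M <= (copid_mx s : 'M[K]_n))%MS.
Proof.
move=> upM; apply/sub_copid_mxP => i j ltjs; rewrite mxE big1 // => k _.
rewrite copid_mxE; case: eqP => [->|_]; last by rewrite mul0r.
by case: leqP => [lesk|_]; rewrite ?mul0r // upM ?mulr0 // (leq_trans ltjs).
Qed.

(** The choice of [s] makes both ranks equal, so either inclusion is an equality. *)
Lemma comparable_copid (U : 'M[K]_n) (s := (n - \rank U)%N) :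
  (copid_mx s <= U)%MS || (U <= (copid_mx s : 'M[K]_n))%MS ->
  (U == (copid_mx s : 'M[K]_n))%MS.
Proof.
have rkE : \rank (copid_mx s : 'M[K]_n) = \rank U.
  by rewrite rank_copid_mx ?leq_subr // subKn ?rank_leq_row.
case/orP=> [leEU|leUE].
  by rewrite leEU andbT -(mxrank_leqif_sup leEU) rkE.
by rewrite leUE /= -(mxrank_leqif_sup leUE) rkE eqxx.
Qed.

End CoordinateFlag.

(** * Maximal triangular algebras as block algebras *)

Lemma maximal_D_block_alg (K : fieldType) (n q : nat) (A : {vspace 'M[K]_n}) :
  is_subalgebra A -> (forall M, M \in A -> is_upper_triangular M) ->
  maximal_for (@is_D_subalgebra K n q) A ->
  exists (ns : 'I_q -> nat) (sum_ns : (\sum_(i < q) ns i)%N = n)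
         (D : forall i, {vspace 'M[K]_(ns i)}),
    [/\ forall i, (0 < ns i)%N, forall i, is_comm_subalgebra (D i)
      & A = block_alg sum_ns D].
Proof.
move=> algA upA maxA; have [[_ DA nDA] _] := maxA.
(* The codimension [s i] will be the first coordinate of [W i], and thus the offset of block [i]. *)
pose W := comm_flag A; pose s i := (n - \rank (W i))%N.
have Wq : W q = 0 := comm_flag_D DA.
have Wdec := comm_flag_dec algA; rewrite -/W in Wdec.
have shiftA M : shifts W M -> M \in A.
  move=> shM; pose B := (A + shift_space q W)%VS.
  have stW := comm_flag_stable algA; have shW := @comm_flag_shifts _ _ A.
  rewrite -(maximal_D_unique (B := B) maxA) ?addvSl //.
  - by apply: subvP (addvSr _ _) _ _; apply/mem_shift_space.
  - exact: shift_sum_subalgebra.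
  - exact: shift_sum_D.
(* Shifts lie in [A], hence are triangular and preserve the coordinate subspace, which is therefore
   comparable with [W i]. *)
have W_copid i : (W i == (copid_mx (s i) : 'M[K]_n))%MS.
  apply: comparable_copid; apply: shift_stable_comparable => // M /shiftA AM.
  exact/copid_mx_upper/upA.
pose ns (i : 'I_q) := (s i.+1 - s i)%N.
have s_lt i : (i < q)%N -> (s i < s i.+1)%N.
  move=> ltiq; apply: ltn_sub2l (comm_flag_strict algA DA nDA ltiq).
  exact: leq_trans (comm_flag_strict algA DA nDA ltiq) (rank_leq_row _).
have sum_s i : (i <= q)%N -> (\sum_(k < q | (k < i)%N) ns k)%N = s i.
  move=> leiq; rewrite -(big_ord_widen q (fun k => s k.+1 - s k)%N leiq).
  rewrite -(big_mkord xpredT (fun k => s k.+1 - s k)%N).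
  rewrite telescope_sumn_in // => [|k /andP[_ ltki]].
    by rewrite /s /W /= mxrank1 subnn subn0.
  by rewrite ltnW // s_lt // (leq_trans ltki).
have sum_ns : (\sum_(i < q) ns i)%N = n.
  rewrite -(eq_bigl _ _ (fun k : 'I_q => ltn_ord k)) sum_s //.
  by rewrite /s Wq mxrank0 subn0.
pose D i := (linfun (block_entry sum_ns i i) @: A)%VS.
have memD i X : X \in D i -> exists2 M, M \in A & X = blk sum_ns M i i.
  by case/memv_imgP => M AM ->; exists M; rewrite // lfunE.
have blkD i M : M \in A -> blk sum_ns M i i \in D i.
  by move=> AM; apply/memv_imgP; exists M; rewrite // lfunE.
have up M : M \in A -> block_upper sum_ns M.
  by move/upA; apply: upper_triangular_block_upper.
(* A basis vector of block [i] lies in [W i], so the commutator sends it into [W i.+1], whose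
   coordinates start only after block [i]. *)
have comm_blk i M N : M \in A -> N \in A -> blk sum_ns (commutator M N) i i = 0.
  move=> AM AN; apply/matrixP => a b; rewrite blkE [RHS]mxE.
  have /andP[_ EW] := W_copid i; have /andP[WE _] := W_copid i.+1.
  have row_E : (('e_(rank_ord sum_ns a) : 'rV[K]_n) *m commutator M N
                <= (copid_mx (s i.+1) : 'M[K]_n))%MS.
    apply: (submx_trans _ WE); apply: (submx_trans _ (comm_flag_shifts AM AN i)).
    apply: submxMr; apply: (submx_trans _ EW); apply/sub_copid_mxP => r j ltjs.
    rewrite mxE; case: (j =P _) => [eqj|]; rewrite ?andbF //.
    by move: ltjs; rewrite eqj val_rank_ord sum_s ?(ltnW (ltn_ord i)) // ltnNge leq_addr.
  have := (sub_copid_mxP _ _).2 row_E 0 (rank_ord sum_ns b).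
  rewrite -rowE mxE; apply.
  rewrite val_rank_ord sum_s ?(ltnW (ltn_ord i)) //.
  by have := ltn_ord b; rewrite /ns ltn_subRL.
have commD i : is_comm_subalgebra (D i).
  split; first split=> [|_ _ /memD[M AM ->] /memD[N AN ->]].
  - by rewrite -(blk1 K sum_ns i); apply: blkD; case: algA.
  - rewrite -blk_mul_diag; [exact/blkD/algA.2|exact: up|exact: up].
  move=> _ _ /memD[M AM ->] /memD[N AN ->]; have [upM upN] := (up M AM, up N AN).
  rewrite -!blk_mul_diag //; apply/eqP; rewrite -subr_eq0 -blkB.
  exact/eqP/comm_blk.
exists ns, sum_ns, D; split=> // [i|]; first by rewrite subn_gt0 s_lt.
apply/esym/(maximal_D_unique maxA).
- by apply/subvP => M AM; apply/mem_block_alg; split=> [i|]; [apply: blkD|apply: up].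
- by apply: block_alg_subalgebra => i; case: (commD i).
- exact: block_alg_D.
Qed.

(** * Replacing one diagonal block *)

Section BlockAlgReplacement.
Variables (K : fieldType) (n q : nat) (ns : 'I_q -> nat).
Variables (sum_ns : (\sum_(i < q) ns i)%N = n) (D : forall i, {vspace 'M[K]_(ns i)}).

Lemma has_type_block_alg : (forall i, (0 < ns i)%N) ->
  (forall i, is_subalgebra (D i)) -> has_type (block_alg sum_ns D) D.
Proof. by move=> ns_gt0 algD; split=> //; exists sum_ns => M; apply: mem_block_alg. Qed.

Variables (i : 'I_q) (B : {vspace 'M[K]_(ns i)}).

Lemma block_alg_dfwithS : (D i <= B)%VS ->
  (block_alg sum_ns D <= block_alg sum_ns (dfwith D B))%VS.
Proof.
move=> /subvP sDB; apply/subvP => M /mem_block_alg[DM upM]; apply/mem_block_alg.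
split=> // j; case: dfwithP => [|k _]; first exact/sDB/DM.
exact: DM.
Qed.

Lemma dfwith_comm : (forall j, is_comm_subalgebra (D j)) -> is_comm_subalgebra B ->
  forall j, is_comm_subalgebra (dfwith D B j).
Proof. by move=> commD commB j; case: dfwithP. Qed.

(** Rank-nullity for the projection to block [i]: both algebras have the same kernel, and the images
    are [B] and [D i]. *)
Lemma block_alg_dfwith_dim :
  (\dim (block_alg sum_ns (dfwith D B)) <= \dim (block_alg sum_ns D))%N ->
  (\dim B <= \dim (D i))%N.
Proof.
pose f := linfun (@block_entry K _ _ _ sum_ns i i).
rewrite -(limg_ker_dim f (block_alg _ D)) -(limg_ker_dim f (block_alg _ (dfwith D B))).
rewrite !block_alg_img dfwith_in.
have -> : (block_alg sum_ns (dfwith D B) :&: lker f = block_alg sum_ns D :&: lker f)%VS.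
  apply/vspaceP => M; apply/memv_capP/memv_capP => -[/mem_block_alg[DM upM] kerM];
    split=> //; apply/mem_block_alg; split=> // j;
    have := kerM; rewrite memv_ker lfunE => /eqP fM0; have := DM j;
    case: dfwithP => // _; by rewrite [blk _ _ _ _]fM0 mem0v.
by rewrite leq_add2l.
Qed.

End BlockAlgReplacement.

Theorem corollary4p9 (K : fieldType) (n q : nat) (A : {vspace 'M[K]_n})
    (n_ge1 : (1 <= n)%N) (q_ge2 : (2 <= q)%N)
    (A_subalgebra : is_subalgebra A)
    (A_upper : forall M : 'M[K]_n, M \in A -> is_upper_triangular M) :
  (maximal_for (@is_D_subalgebra K n q) A ->
     exists ns : 'I_q -> nat, D_of_type_max_comm A ns)
  /\
  (maxdim_for (@is_D_subalgebra K n q) A ->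
     exists ns : 'I_q -> nat, maxdim_D_of_type_max_dim A ns).
Proof.
split=> [maxA|maxdimA].
  have [ns [sum_ns [D [ns_gt0 commD eqA]]]] := maximal_D_block_alg A_subalgebra A_upper maxA.
  exists ns, D; split; first by case: maxA.
    by rewrite eqA; apply: has_type_block_alg => // i; case: (commD i).
  move=> i; split=> // B commB sDB.
  have commDB := dfwith_comm commD commB.
  (* Enlarging block [i] keeps the algebra D_q and above [A], so nothing changes; projecting to
     block [i] then gives [B = D i]. *)
  have eqDB : block_alg sum_ns (dfwith D B) = A.
    apply: maximal_D_unique maxA _ _ _; last exact: block_alg_D.
      by rewrite eqA; apply: block_alg_dfwithS.
    by apply: block_alg_subalgebra => j; case: (commDB j).
  by rewrite -(dfwith_in D B) -(block_alg_img sum_ns) eqDB eqA block_alg_img.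
have maxA := maxdim_maximal maxdimA.
have [ns [sum_ns [D [ns_gt0 commD eqA]]]] := maximal_D_block_alg A_subalgebra A_upper maxA.
exists ns, D; split=> //.
  by rewrite eqA; apply: has_type_block_alg => // i; case: (commD i).
move=> i; split=> // B commB; apply: (@block_alg_dfwith_dim _ _ _ _ sum_ns).
rewrite -eqA; apply: maxdimA.2.
have commDB := dfwith_comm commD commB.
have algDB j : is_subalgebra (dfwith D B j) by case: (commDB j).
(* Here [B] need not contain [D i], so failure of D_(q-1) cannot be inherited from [A] and comes
   from the block structure. *)
split; [exact: block_alg_subalgebra | exact: block_alg_D | ].
by apply: block_alg_notD => //; apply: ltnW.
Qed.
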